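(* Let $\Gamma$ be a cofinite downset of $\mathrm{M}_{\mathrm{PCL}}$ and let $\Gamma_{\min}$ be the set of minimal elements of $\mathrm{M}_{\mathrm{PCL}}\setminus\Gamma$ (minimal with respect to the order of $\mathrm{M}_{\mathrm{PCL}}$). Then \[\mathbb{C}:=\prod_{\Sigma\in\Gamma_{\min}}\mathbb{G}_{\Sigma}\] is a finite disjoint union of cycles and $\operatorname{PCL}(\mathbb{C})=\Gamma$.
   Context: A clone is a set of operations of arity $\geq1$ on a fixed nonempty set that contains all projections and is closed under composition. For a finite nonempty set $P$ of primes let $V_P=\{(p,k)\mid p\in P,k\in\mathbb{Z}_p\}$ and $\sigma_P\colon V_P\to V_P$, $(p,k)\mapsto(p,k+1)$. The prime cyclic loop condition $\Sigma_P$ is the identity $f\approx f_{\sigma_P}$: a clone $\mathcal{C}$ on $A$ satisfies it ($\mathcal{C}\models\Sigma_P$) if it contains an operation $f\colon A^{V_P}\to A$ (identify $V_P$ with $\{1,\dots,|V_P|\}$ by any bijection) with $f(t)=f(t\circ\sigma_P)$ for all $t\in A^{V_P}$. $\Sigma_P\Rightarrow\Sigma_Q$ means that every clone satisfying $\Sigma_P$ satisfies $\Sigma_Q$. Distinct prime cyclic loop conditions are not equivalent, so $\mathrm{M}_{\mathrm{PCL}}$ denotes the set of all prime cyclic loop conditions, partially ordered by $\Leftarrow$: $\Sigma_Q\leq\Sigma_P$ iff $\Sigma_P\Rightarrow\Sigma_Q$. A downset is cofinite if its complement in $\mathrm{M}_{\mathrm{PCL}}$ is finite. $\mathbb{G}_{\Sigma_P}$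 is the digraph with vertex set $V_P$ and edges $((p,k),(p,k+1))$, i.e. the disjoint union of one directed cycle of length $p$ for each $p\in P$. $\prod$ denotes the direct (categorical) product of digraphs, with componentwise edges; the empty product is the one-vertex digraph with a loop. A finite disjoint union of cycles is a finite nonempty digraph all of whose connected components are directed cycles (a loop is a cycle of length 1). $\operatorname{Pol}(\mathbb{C})$ is the clone of all homomorphisms $\mathbb{C}^n\to\mathbb{C}$, $n\geq1$, and $\operatorname{PCL}(\mathbb{C})=\{\Sigma\mid\Sigma\text{ a prime cyclic loop condition and }\operatorname{Pol}(\mathbb{C})\models\Sigma\}$. *)

(* Defs.v *)
From HB Require Import structures.
From Stdlib Require Import Relation_Operators.
From mathcomp Require Import all_boot all_order all_algebra finmap.
From mathcomp Require Import all_classical.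

Set Implicit Arguments.
Unset Strict Implicit.
Unset Printing Implicit Defensive.

Import GRing.Theory.
Local Open Scope classical_set_scope.

(* An n-ary operation on A is a function ('I_n -> A) -> A.  The base set is
   required to be nonempty where clones are quantified over (see [pcl_implies]). *)
Record clone (A : Type) := Clone {
  ops : forall n, set (('I_n -> A) -> A);
  ops_arity : forall n (f : ('I_n -> A) -> A), ops f -> 0 < n;
  ops_proj : forall n (i : 'I_n), ops (fun x : 'I_n -> A => x i);
  ops_comp : forall n m (f : ('I_n -> A) -> A) (g : 'I_n -> ('I_m -> A) -> A),
    ops f -> (forall i, ops (g i)) -> ops (fun x => f (fun i => g i x))
}.

(* Prime cyclic loop conditions.  The condition Sigma_P is represented by its
   index P; distinct P yield inequivalent conditions. *)
Record pcl := Pcl {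
  pcl_primes :> {fset nat};
  pclP : (pcl_primes != fset0) && all prime pcl_primes
}.

HB.instance Definition _ := [isSub for pcl_primes].
HB.instance Definition _ := [Choice of pcl by <:].

(* 'Z_n is the integers mod n only for n > 1, which holds for primes. *)
Definition pclV (P : pcl) := {p : P & 'Z_(val p)}.

Definition pcl_sigma (P : pcl) (v : pclV P) : pclV P :=
  Tagged (fun p : P => 'Z_(val p)) (tagged v + 1)%R.

(* V_P is identified with 'I_#|V_P| through its standard enumeration. *)
Definition satisfies (A : Type) (C : clone A) (P : pcl) : Prop :=
  exists2 f : ('I_#|{: pclV P}| -> A) -> A,
    ops C f &
    forall t : pclV P -> A,
      f (fun i => t (enum_val i)) = f (fun i => t (pcl_sigma (enum_val i))).

Definition pcl_implies (P Q : pcl) : Prop :=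
  forall (A : Type) (C : clone A), inhabited A -> satisfies C P -> satisfies C Q.

Definition pcl_le (Q P : pcl) : Prop := pcl_implies P Q.

Definition downset (G : set pcl) : Prop :=
  forall P Q, G P -> pcl_le Q P -> G Q.

Definition cofinite (G : set pcl) : Prop := finite_set (~` G).

Definition minimal_elements (S : set pcl) : set pcl :=
  [set P | S P /\ forall Q, S Q -> pcl_le Q P -> Q = P].

Record digraph := Digraph {
  vertex :> Type;
  edge : vertex -> vertex -> Prop
}.

Definition digraph_prod (I : Type) (G : I -> digraph) : digraph :=
  {| vertex := forall i, G i;
     edge := fun x y => forall i, edge (x i) (y i) |}.

Definition digraph_pow (G : digraph) (n : nat) : digraph :=
  digraph_prod (fun _ : 'I_n => G).

Definition digraph_hom (G H : digraph) (f : G -> H) : Prop :=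
  forall x y, edge x y -> edge (f x) (f y).

Definition digraph_iso (G H : digraph) : Prop :=
  exists2 f : G -> H,
    bijective f & forall x y, edge x y <-> edge (f x) (f y).

Definition induced (G : digraph) (S : set G) : digraph :=
  {| vertex := S; edge := fun x y => edge (val x) (val y) |}.

(* Weakly connected component of x. *)
Definition component (G : digraph) (x : G) : set G :=
  [set y | clos_refl_sym_trans G (@edge G) x y].

(* For n = 1 this is a loop. *)
Definition directed_cycle (n : nat) : digraph :=
  {| vertex := 'I_n; edge := fun i j => j = ordS i |}.

Definition finite_disjoint_union_of_cycles (G : digraph) : Prop :=
  [/\ finite_set [set: G], inhabited G &
      forall x : G, exists2 n, 0 < n &
        digraph_iso (induced (component x)) (directed_cycle n)].

Definition pcl_digraph (P : pcl) : digraph :=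
  {| vertex := pclV P; edge := fun u v => v = pcl_sigma u |}.

Definition pol_ops (G : digraph) (n : nat) : set (('I_n -> G) -> G) :=
  [set f | 0 < n /\ @digraph_hom (digraph_pow G n) G f].

Lemma pol_ops_arity (G : digraph) n (f : ('I_n -> G) -> G) :
  pol_ops f -> 0 < n.
Proof. by case. Qed.

Lemma pol_ops_proj (G : digraph) n (i : 'I_n) :
  pol_ops (fun x : 'I_n -> G => x i).
Proof. by split=> [|x y]; [case: i; case: n | exact]. Qed.

Lemma pol_ops_comp (G : digraph) n m
    (f : ('I_n -> G) -> G) (g : 'I_n -> ('I_m -> G) -> G) :
  pol_ops f -> (forall i, pol_ops (g i)) ->
  pol_ops (fun x => f (fun i => g i x)).
Proof.
move=> [n0 fP] gP; split; first by case: (gP (Ordinal n0)).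
by move=> x y xy; apply: fP => i; apply: (gP i).2.
Qed.

Definition Pol (G : digraph) : clone G :=
  Clone (@pol_ops_arity G) (@pol_ops_proj G) (@pol_ops_comp G).

Definition PCL (G : digraph) : set pcl := [set P | satisfies (Pol G) P].

(* Main.v *)
(** Finite disjoint unions of cycles are the graphs of permutations of finite
    order, and a polymorphism is an operation commuting with the permutation.
    If p lies in P but not in Q, a p-ary cyclic polymorphism of G_Q is found by
    choosing its value on one representative of each orbit of the group
    generated by the permutation and the cyclic shift: stabilizers cause no
    obstruction because p is prime to the lengths of the cycles.  Hence Sigma_P
    implies Sigma_Q iff P is contained in Q, and the minimal elements of the
    complement of Gamma are the inclusion-maximal index sets outside Gamma.

    If P is contained in such a maximal Q, pick a prime s_S in S \ Q for every
    other maximal S and let m be the product of the s_S.  The m-th power of the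
    permutation of C has no fixed point, as m is prime to the cycle lengths of
    G_Q, but for each p in P it has a point of period dividing p, namely one
    on the p-cycle of G_Q and on the s_S-cycles elsewhere.  A polymorphism
    witnessing Sigma_P would turn these points into a fixed point. *)
Require Import Defs.
From Stdlib Require Import Relation_Operators.
From mathcomp Require Import all_boot all_algebra finmap all_classical.
Import GRing.Theory.
Local Open Scope classical_set_scope.

Set Implicit Arguments.
Unset Strict Implicit.
Unset Printing Implicit Defensive.

(** * Iterates of a map and return times *)

Lemma iter_mull (T : Type) (s : T -> T) (x : T) n q :
  iter n s x = x -> iter (q * n) s x = x.
Proof. by move=> snx; rewrite iterM; elim: q => //= q ->. Qed.

Lemma iter_dvdn (T : Type) (s : T -> T) (x : T) n k :
  iter n s x = x -> n %| k -> iter k s x = x.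
Proof. by move=> snx /dvdnP[q ->]; apply: iter_mull. Qed.

Lemma iter_mod (T : Type) (s : T -> T) (x : T) n k :
  iter n s x = x -> iter (k %% n) s x = iter k s x.
Proof.
by move=> snx; rewrite {2}(divn_eq k n) addnC iterD iter_mull.
Qed.

Lemma iter_eq_mod (T : Type) (s : T -> T) (x : T) n a b :
  iter n s x = x -> a = b %[mod n] -> iter a s x = iter b s x.
Proof. by move=> snx ab; rewrite -(iter_mod a snx) ab iter_mod. Qed.

Lemma iter_inj (T : Type) (s : T -> T) n : injective s -> injective (iter n s).
Proof. by move=> s_inj; elim: n => //= n IHn x y /s_inj /IHn. Qed.

Lemma minimal_period (T : Type) (s : T -> T) (x : T) N :
  injective s -> 0 < N -> iter N s x = x ->
  exists2 n, 0 < n &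
    forall a b, iter a s x = iter b s x <-> a = b %[mod n].
Proof.
move=> s_inj N0 sNx.
have ex : exists n, (0 < n) && `[< iter n s x = x >].
  by exists N; rewrite N0; apply/asboolP.
case: (ex_minnP ex) => n /andP[n0 /asboolP snx] nmin.
exists n => // a b; split; last exact: iter_eq_mod snx.
rewrite -(iter_mod a snx) -(iter_mod b snx).
move: (a %% n) (b %% n) (ltn_pmod a n0) (ltn_pmod b n0) => {}a {}b.
wlog ab : a b / a <= b.
  move=> W an bn ab; case/orP: (leq_total a b) => le; first exact: W.
  by apply/esym/W.
move=> _ bn; rewrite -(subnKC ab) iterD => /(iter_inj s_inj) /esym sx.
case: (posnP (b - a)) => [->|d0]; first by rewrite addn0.
have := nmin (b - a); rewrite d0 => /(_ (asboolT sx)).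
by rewrite leqNgt (leq_ltn_trans (leq_subr _ _) bn).
Qed.

(** * Equivariant maps and cyclic operations *)

(** Choose a value on one representative of each [h]-orbit and transport it along the orbit; [stab]
    makes the result independent of the number of steps taken. *)
Lemma equivariant_map (X T : Type) (h : X -> X) (s : T -> T) (M : nat)
    (z : X -> T) (x0 : X) :
  0 < M -> (forall x, iter M h x = x) -> (forall u, iter M s u = u) ->
  (forall x k, iter k h x = x -> iter k s (z x) = z x) ->
  exists f : X -> T, forall x, f (h x) = s (f x).
Proof.
move=> M0 hM sM stab.
(* Forward orbits suffice: as [iter M h] is the identity, [M.-1] further steps undo one step. *)
pose orb x := [set y | exists a, y = iter a h x].
have orbh x : orb (h x) = orb x.
  apply/seteqP; split=> y [a ->]; first by exists a.+1; rewrite iterSr.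
  by exists (a + M.-1); rewrite iterD -iterSr prednK // hM.
(* The representative depends only on the orbit as a set; [x0] is the default on the empty set. *)
have [rho rhoP] : exists rho : set X -> X, forall x, orb x (rho (orb x)).
  have /choice[rho rhoP] : forall A : set X, exists y, A !=set0 -> A y.
    move=> A; have [[y Ay]|A0] := pselect (A !=set0); first by exists y.
    by exists x0.
  by exists rho => x; apply: rhoP; exists x, 0.
have rep x : exists a, x = iter a h (rho (orb x)).
  have [a ->] := rhoP x; exists (a * M.-1).
  by rewrite -iterD addnC -mulnS prednK // iter_mull.
have /choice[f fP] : forall x, exists u, exists2 a,
    x = iter a h (rho (orb x)) & u = iter a s (z (rho (orb x))).
  by move=> x; have [a xE] := rep x; exists (iter a s (z (rho (orb x)))), a.
exists f => x; have [a xE ->] := fP x; have [b hxE ->] := fP (h x).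
move: xE hxE; rewrite orbh; set r := rho _ => xE hxE.
rewrite -iterS.
(* Both expressions for [h x] start at [r]: [b] steps followed by undoing [a.+1] steps return to
   [r], where [stab] applies. *)
have hab : iter (a.+1 * M.-1 + b) h r = r.
  rewrite iterD -hxE xE -iterS -iterD -mulnSr prednK //.
  by rewrite iter_mull.
have /(congr1 (iter a.+1 s)) := stab _ _ hab.
rewrite -iterD addnA -mulnS prednK // addnC iterD.
by rewrite iter_mull.
Qed.

Lemma cyclic_equivariant_operation (T : Type) (t0 : T) (s : T -> T)
    (N p : nat) :
  0 < N -> 1 < p -> coprime p N -> (forall u, iter N s u = u) ->
  exists2 f : ('Z_p -> T) -> T,
    forall t, f (s \o t) = s (f t) & forall t, f (fun k => t (k + 1)%R) = f t.
Proof.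
move=> N0 p1 co_pN sN.
(* By the Chinese remainder theorem [s] and the shift are both powers of [h]. *)
pose h (t : 'Z_p -> T) := fun k => s (t (k + 1)%R).
have hE a t : iter a h t = fun k => iter a s (t (k + a%:R)%R).
  elim: a => [|a IHa]; apply: funext => k /=; first by rewrite addr0.
  by rewrite IHa /h /= -addrA nat1r.
have Zp n k : n = k %[mod p] -> n%:R%R = k%:R%R :> 'Z_p.
  by move=> nk; apply: val_inj; rewrite /= !val_Zp_nat.
have hM t : iter (p * N) h t = t.
  rewrite hE; apply: funext => k.
  by rewrite iter_mull // natrM pchar_Zp // mul0r addr0.
have [e e1 e2] : exists2 e, e = 0 %[mod p] & e = 1 %[mod N].
  by exists (chinese p N 0 1); rewrite (chinese_modl, chinese_modr).
have [c c1 c2] : exists2 c, c = 1 %[mod p] & c = 0 %[mod N].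
  by exists (chinese p N 1 0); rewrite (chinese_modl, chinese_modr).
have [|||x k hk|f fP] := @equivariant_map _ T h s (p * N) (fun t => t 0%R)
    (fun=> t0).
- by rewrite muln_gt0 N0 ltnW.
- exact: hM.
- by move=> u; apply: iter_mull.
(* By the choice of [e], [iter (k * e) h] applies [iter k s] to each entry without shifting, so
   [iter k s] fixes [x 0]. *)
- have /(congr1 (fun t => t 0%R)) : iter (k * e) h x = x.
    exact: iter_dvdn hk (dvdn_mulr _ _).
  rewrite hE add0r natrM (Zp _ _ e1) mulr0 => xE; rewrite -{2}xE.
  by apply: iter_eq_mod (sN _) _; rewrite -modnMmr e2 modnMmr muln1.
have fI a t : f (iter a h t) = iter a s (f t).
  by elim: a => //= a IHa; rewrite fP IHa.
exists f => t.
  have <- : iter e h t = s \o t.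
    rewrite hE; apply: funext => k; rewrite (Zp _ _ e1) addr0.
    exact: iter_eq_mod (sN _) e2.
  by rewrite fI; apply: iter_eq_mod (sN _) e2.
have <- : iter c h t = fun k => t (k + 1)%R.
  rewrite hE; apply: funext => k; rewrite (Zp _ _ c1).
  exact: iter_eq_mod (sN _) c2.
by rewrite fI; apply: iter_eq_mod (sN _) c2.
Qed.

(** * Satisfaction of prime cyclic loop conditions *)

Lemma pcl_prime (P : pcl) (p : P) : prime (val p).
Proof. by have /andP[_ /allP] := pclP P; apply; apply: valP. Qed.

Lemma iter_pcl_sigma (P : pcl) (v : pclV P) k :
  iter k (@pcl_sigma P) v =
  Tagged (fun p : P => 'Z_(val p)) (tagged v + k%:R)%R.
Proof.
case: v => p i; elim: k => [|k IHk] /=; first by rewrite addr0.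
by rewrite IHk /pcl_sigma /= -addrA natr1.
Qed.

Lemma iter_pcl_sigma_fix (P : pcl) (v : pclV P) k :
  iter k (@pcl_sigma P) v = v <-> val (tag v) %| k.
Proof.
have p1 := prime_gt1 (pcl_prime (tag v)).
rewrite iter_pcl_sigma; case: v p1 => p i /= p1; split.
  move/eqP; rewrite eq_Tagged /= => /eqP /(canRL (addKr _)).
  by rewrite addNr => /(congr1 val) /=; rewrite val_Zp_nat // => /eqP.
move=> pk; congr Tagged; rewrite -[RHS]addr0; congr (_ + _)%R.
by apply: val_inj; rewrite /= val_Zp_nat //; apply/eqP.
Qed.

Lemma pclV_inhabited (P : pcl) : inhabited (pclV P).
Proof.
have /andP[/fset0Pn[p pP] _] := pclP P.
by constructor; exists [` pP]%fset; apply: 0%R.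
Qed.

Lemma ops_minor (A : Type) (C : clone A) n m (h : 'I_n -> 'I_m)
    (f : ('I_n -> A) -> A) :
  ops C f -> ops C (fun x => f (fun i => x (h i))).
Proof.
move=> Cf; apply: (@ops_comp _ C n m f (fun i x => x (h i)) Cf) => i.
exact: ops_proj.
Qed.

(** [pclV P] embeds in [pclV Q] compatibly with the shifts, so a witness for [P] becomes one for [Q]
    by adding dummy coordinates. *)
Lemma satisfies_sub (A : Type) (C : clone A) (P Q : pcl) :
  (P `<=` Q)%fset -> satisfies C P -> satisfies C Q.
Proof.
move=> /fsubsetP PQ [f Cf fP].
pose inc (v : pclV P) : pclV Q :=
  existT (fun q : Q => 'Z_(val q)) [` PQ _ (valP (tag v))]%fset (tagged v).
exists (fun x => f (fun i => x (enum_rank (inc (enum_val i))))).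
  exact: ops_minor.
move=> t; under eq_fun do rewrite enum_rankK.
rewrite (fP (t \o inc)) /=.
by congr f; apply: funext => i; rewrite enum_rankK.
Qed.

Definition is_graph (G : digraph) (s : G -> G) :=
  forall x y, edge x y <-> y = s x.

Lemma satisfies_cyclic (G : digraph) (s : G -> G) (N : nat) (P : pcl) (p : P) :
  is_graph s -> inhabited G -> 0 < N -> (forall u, iter N s u = u) ->
  coprime (val p) N -> satisfies (Pol G) P.
Proof.
move=> Gs [x0] N0 sN co_pN.
have p1 := prime_gt1 (pcl_prime p).
have [f fs f1] := cyclic_equivariant_operation x0 N0 p1 co_pN sN.
pose pt (k : 'Z_(val p)) : pclV P := existT (fun q : P => 'Z_(val q)) p k.
exists (fun x => f (fun k : 'Z_(val p) => x (enum_rank (pt k)))).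
  split; first by apply/card_gt0P; exists (pt 0%R).
  move=> x y xy; apply/Gs; rewrite -fs; congr f; apply: funext => k.
  by apply/Gs; apply: xy.
move=> t; rewrite -f1; congr f; apply: funext => k.
by rewrite !enum_rankK.
Qed.

Lemma satisfies_prod (I : Type) (G : I -> digraph) (P : pcl) :
  (forall i, satisfies (Pol (G i)) P) -> satisfies (Pol (digraph_prod G)) P.
Proof.
move=> GP.
pose F i : ('I_#|{: pclV P}| -> G i) -> G i := s2val (cid2 (GP i)).
have FP i : ops (Pol (G i)) (F i) := s2valP (cid2 (GP i)).
have FE i (t : pclV P -> G i) :
    F i (fun j => t (enum_val j)) = F i (fun j => t (pcl_sigma (enum_val j))).
  exact: (s2valP' (cid2 (GP i))).
exists (fun x i => F i (fun j => x j i)).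
  split; first by have [v] := pclV_inhabited P; apply/card_gt0P; exists v.
  by move=> x y xy i; apply: (FP i).2 => j; apply: xy.
by move=> t; apply: functional_extensionality_dep => i;
  exact: (FE i (fun v => t v i)).
Qed.

Lemma satisfies_fixpoint (G : digraph) (s : G -> G) (P : pcl) (m : nat)
    (x : P -> G) :
  is_graph s -> (forall p : P, iter (val p * m) s (x p) = x p) ->
  satisfies (Pol G) P -> exists y, iter m s y = y.
Proof.
move=> Gs xP [f [_ f_hom] fP].
have f_iter a t : f (fun i => iter a s (t i)) = iter a s (f t).
  by elim: a => //= a <-; apply/Gs/f_hom => i; apply/Gs.
(* [t] intertwines [pcl_sigma] with the [m]-th power of [s]. *)
pose t (v : pclV P) := iter (tagged v * m) s (x (tag v)).
exists (f (fun i => t (enum_val i))); rewrite [RHS]fP -f_iter.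
congr f; apply: funext => i; case: (enum_val i) => p k.
(* Since [x p] returns after [val p * m] steps, the wrap-around of [k + 1] in ['Z_(val p)] is
   harmless. *)
rewrite /t /= -iterD -mulSn; apply: iter_eq_mod (xP p) _.
have p1 := prime_gt1 (pcl_prime p).
suff E : (k + 1 : 'Z_(val p))%R = k.+1 %% val p :> nat.
  by rewrite [X in _ = (X * m) %% _]E muln_modl modn_mod.
by rewrite -[in LHS](natr_Zp k) natr1 val_Zp_nat.
Qed.

Lemma pcl_digraph_graph (P : pcl) : @is_graph (pcl_digraph P) (@pcl_sigma P).
Proof. by []. Qed.

Lemma digraph_prod_graph (I : Type) (G : I -> digraph)
    (s : forall i, G i -> G i) :
  (forall i, is_graph (s i)) ->
  @is_graph (digraph_prod G) (fun x i => s i (x i)).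
Proof.
move=> Gs x y; split=> [xy|-> i]; last exact/Gs.
by apply: functional_extensionality_dep => i; apply/Gs.
Qed.

Lemma satisfies_pcl_digraph (P Q : pcl) :
  satisfies (Pol (pcl_digraph Q)) P <-> ~~ (P `<=` Q)%fset.
Proof.
split.
  move=> PG; apply/negP => PQ.
  have /fsubsetP sub := PQ.
  (* Taking [m] to be 1 yields a fixed point of the shift itself, whose cycle length would be a
     prime dividing 1. *)
  have [|y /iter_pcl_sigma_fix] := @satisfies_fixpoint (pcl_digraph Q)
    (@pcl_sigma Q) P 1
    (fun p => existT (fun q : Q => 'Z_(val q)) [` sub _ (valP p)]%fset 0%R)
    (@pcl_digraph_graph Q) _ PG.
    by move=> p; rewrite muln1; apply/iter_pcl_sigma_fix.
  by rewrite dvdn1 => /eqP q1; have := pcl_prime (tag y); rewrite q1.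
move=> /fsubsetPn[p pP pQ].
pose N := \prod_(q <- enum_fset Q) q.
have Qprime q : q \in pcl_primes Q -> prime q.
  by move=> qQ; apply: (pcl_prime [` qQ]%fset).
have Pprime : prime p := pcl_prime [` pP]%fset.
apply: (@satisfies_cyclic _ _ N P [` pP]%fset (@pcl_digraph_graph Q)).
- exact: pclV_inhabited.
- by rewrite /N big_seq; apply: prodn_cond_gt0 => q /Qprime /prime_gt0.
- move=> v; apply/iter_pcl_sigma_fix.
  by rewrite /N (big_rem (val (tag v))) ?dvdn_mulr //; apply: valP.
- rewrite /= /N big_seq prime_coprime // Euclid_dvd_prod // big_has_cond.
  apply/hasPn => q _; apply/negP => /andP[qQ].
  by rewrite dvdn_prime2 ?(Qprime q) // => /eqP pq; rewrite pq qQ in pQ.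
Qed.

(** The separating clone is that of [pcl_digraph Q]: it violates [Q], but satisfies [P] as soon as
    [P] is not inside [Q]. *)
Lemma pcl_leE (P Q : pcl) : pcl_le Q P <-> (P `<=` Q)%fset.
Proof.
split=> [PQ|PQ A C _]; last exact: satisfies_sub.
apply/negPn/negP => /satisfies_pcl_digraph /PQ.
by move=> /(_ (pclV_inhabited Q)) /satisfies_pcl_digraph; rewrite fsubset_refl.
Qed.

(** * Components of the graph of a permutation of finite order *)

Lemma component_graph (G : digraph) (s : G -> G) (N : nat) (x y : G) :
  is_graph s -> 0 < N -> (forall u, iter N s u = u) ->
  component x y <-> exists a, y = iter a s x.
Proof.
move=> Gs N0 sN; split=> [xy|[a ->]]; last first.
  elim: a => [|a IHa] /=; first exact: rst_refl.
  by apply: rst_trans IHa _; apply: rst_step; apply/Gs.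
(* An edge preserves orbit membership in both directions: a predecessor is reached by [N.-1] further
   steps. *)
suff orbit_iff u v : clos_refl_sym_trans G (@edge G) u v ->
    (exists a, u = iter a s x) <-> (exists a, v = iter a s x).
  by apply/(orbit_iff x y xy); exists 0.
elim=> [{}u {}v /Gs ->|//|{}u {}v _ ->//|{}u {}v w _ -> _ ->//].
split=> [[a ->]|[a sua]]; first by exists a.+1.
by exists (N.-1 + a); rewrite iterD -sua -iterSr prednK.
Qed.

Lemma is_graph_cycles (G : digraph) (s : G -> G) (N : nat) :
  is_graph s -> finite_set [set: G] -> inhabited G ->
  0 < N -> (forall u, iter N s u = u) -> finite_disjoint_union_of_cycles G.
Proof.
move=> Gs Gfin G0 N0 sN; split=> // x.
have s_inj : injective s.
  move=> u v /(congr1 (iter N.-1 s)).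
  by rewrite -!iterSr prednK // !sN.
have [n n0 nP] := minimal_period s_inj N0 (sN x); exists n => //.
have compP y : component x y <-> exists k : 'I_n, y = iter k s x.
  split=> [xy|[k ->]]; last by apply/(component_graph _ _ Gs N0 sN); exists k.
  have [a ->] := (component_graph _ _ Gs N0 sN).1 xy.
  by exists (Ordinal (ltn_pmod a n0)) => /=; apply/nP; rewrite modn_mod.
have /choice[f fE] : forall y : induced (component x),
    exists k : 'I_n, val y = iter k s x.
  by move=> y; apply/compP/set_mem/valP.
have gP (k : 'I_n) : iter k s x \in component x.
  by apply/mem_set/compP; exists k.
pose g (k : 'I_n) : induced (component x) :=
  exist (fun y => y \in component x) _ (gP k).
exists f.
  exists g => [y|k]; first by apply: val_inj; rewrite /= -fE.
  by apply: ord_inj; have /nP := esym (fE (g k)); rewrite !modn_small.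
move=> u v; rewrite /edge/=; split.
  move=> /Gs; rewrite !fE -iterS => /nP e; apply: ord_inj.
  by rewrite /= -e modn_small.
move=> e; apply/Gs; rewrite !fE -iterS; apply/nP.
by rewrite e /= modn_mod.
Qed.

(** * The product over the minimal elements *)

(** Reindexing by the finite type [X] gives a finite type of dependent functions, which [ext] maps
    onto the product. *)
Lemma finite_pcl_prod (A : set pcl) :
  finite_set A -> finite_set [set: forall S : A, pclV (val S)].
Proof.
move=> /finite_fsetP[X AX].
have XA (j : X) : val j \in A by apply/mem_set; rewrite AX; apply: valP.
have AX' (S : A) : val S \in X by have /set_mem := valP S; rewrite {1}AX.
pose ext (g : {dffun forall j : X, pclV (val j)}) :
  forall S : A, pclV (val S) := fun S => g [` AX' S]%fset.
suff -> : [set: forall S : A, pclV (val S)] = ext @` setT.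
  exact/finite_image/finite_finset.
apply/seteqP; split=> // x _.
exists [ffun j : X => x (exist (fun S => S \in A) (val j) (XA j))
  : pclV (val j)] => //.
apply: functional_extensionality_dep => S; rewrite /ext ffunE.
by case: S => S SA; congr (x (exist _ _ _)); apply: bool_irrelevance.
Qed.

Theorem lemma6p13 (Gamma : set pcl)
    (Gamma_down : downset Gamma) (Gamma_cofin : cofinite Gamma) :
  let C := digraph_prod
             (fun S : minimal_elements (~` Gamma) => pcl_digraph (val S)) in
  finite_disjoint_union_of_cycles C /\ PCL C = Gamma.
Proof.
set A := minimal_elements _ => C.
have Afin : finite_set A by apply: sub_finite_set Gamma_cofin => P [].
pose s : C -> C := fun x S => pcl_sigma (x S).
have sE k x : iter k s x = fun S => iter k (@pcl_sigma _) (x S).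
  by elim: k => //= k ->.
have Cs : is_graph s.
  exact: (@digraph_prod_graph _ (fun S : A => pcl_digraph (val S))
    (fun S => @pcl_sigma (val S))).
have [X AX] := finite_fsetP.1 Afin.
have XA S : A S -> S \in X by rewrite AX.
have outP P : A P -> ~ Gamma P by case.
split.
  pose primes (S : pcl) := enum_fset (pcl_primes S).
  (* A common multiple of the cycle lengths in all factors. *)
  pose N := \prod_(S <- enum_fset X) \prod_(p <- primes S) p.
  apply: (is_graph_cycles (N := N) Cs).
  - exact: finite_pcl_prod.
  - by constructor=> S; apply: inhabited_witness (pclV_inhabited _).
  - apply: prodn_gt0 => S; rewrite big_seq; apply: prodn_cond_gt0 => p pS.
    exact/prime_gt0/(pcl_prime [` pS]%fset).
  - move=> x; rewrite sE; apply: functional_extensionality_dep => S.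
    apply/iter_pcl_sigma_fix.
    rewrite /N (big_rem (val S)) ?dvdn_mulr //; last exact/XA/set_mem/valP.
    by rewrite (big_rem (val (tag (x S)))) ?dvdn_mulr //; apply: valP.
have max_sub P Q : A P -> A Q -> (P `<=` Q)%fset -> P = Q.
  by move=> [_ Pmin] [GQ _] /pcl_leE /(Pmin _ GQ).
have A_above P : ~ Gamma P -> exists2 Q, A Q & (P `<=` Q)%fset.
  move=> GP; have [Y YE] := finite_fsetP.1 Gamma_cofin.
  have YP R : (~` Gamma) R <-> R \in Y by rewrite YE.
  have PY : P \in Y by apply/YP.
  (* Among the finitely many index sets outside [Gamma] that contain [P], one of largest cardinality
     is inclusion-maximal. *)
  case: (@arg_maxnP Y [` PY]%fset (fun R => P `<=` val R)%fset
    (fun R => #|` val R|)) => [|Q PQ Qmax]; first exact: fsubset_refl.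
  exists (val Q) => //; split=> [|R /YP RY /pcl_leE QR].
    by apply/YP; apply: valP.
  apply/val_inj/eqP; rewrite eq_sym eqEfcard QR /=.
  exact: (Qmax [` RY]%fset (fsubset_trans PQ QR)).
apply/seteqP; split=> P; last first.
  (* A factor violating [P] would have [P] inside [Q], and the downset [Gamma] would then contain
     [Q]. *)
  move=> GP; apply: satisfies_prod => -[Q QA] /=.
  apply/satisfies_pcl_digraph/negP => /pcl_leE PQ.
  by have /outP := set_mem QA; apply; apply: Gamma_down GP PQ.
move=> PC; apply: contrapT => /A_above[Q AQ PQ].
have /choice[w wP] : forall S, exists r : nat, A S -> S <> Q ->
    r \in pcl_primes S /\ r \notin pcl_primes Q.
  move=> S; have [SQ|/fsubsetPn[r rS rQ]] := boolP (S `<=` Q)%fset.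
    (* The value [0] is a placeholder: here [A S] would force [S = Q]. *)
    by exists 0 => AS []; apply: max_sub.
  by exists r.
pose m := \prod_(S <- enum_fset X | S != Q) w S.
have periodic (p : P) (S : A) :
    exists v : pclV (val S), iter (val p * m) (@pcl_sigma _) v = v.
  have [SQ|SQ] := eqVneq (val S) Q.
    have pS : val p \in pcl_primes (val S).
      by rewrite SQ; apply: (fsubsetP PQ); apply: valP.
    exists (existT (fun q : val S => 'Z_(val q)) [` pS]%fset 0%R).
    by apply/iter_pcl_sigma_fix; rewrite dvdn_mulr.
  have AS : A (val S) by apply/set_mem/valP.
  have [wS _] := wP _ AS (elimN eqP SQ).
  exists (existT (fun q : val S => 'Z_(val q)) [` wS]%fset 0%R).
  apply/iter_pcl_sigma_fix; rewrite dvdn_mull //.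
  by rewrite /m (big_rem (val S)) ?SQ ?dvdn_mulr //; apply: XA.
have [|y] := @satisfies_fixpoint C _ P m
  (fun p S => sval (cid (periodic p S))) Cs _ PC.
  move=> p; rewrite sE; apply: functional_extensionality_dep => S.
  exact: svalP (cid (periodic p S)).
(* In coordinate [Q] the fixed point lies on a cycle of prime length [q] dividing [m], so [q] equals
   some [w S], which is not in [Q]. *)
rewrite sE => /(congr1 (fun x : C => x (exist _ Q (mem_set AQ)))).
move=> /iter_pcl_sigma_fix; set q := tag _.
have q_prime := pcl_prime q.
rewrite /m big_seq_cond Euclid_dvd_prod // big_has_cond => /hasP[S _].
move=> /andP[/andP[SX /eqP SQ]].
have AS : A S by rewrite AX.
have [wS wQ] := wP S AS SQ.
rewrite dvdn_prime2 //; last exact: (pcl_prime [` wS]%fset).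
by move=> /eqP qw; rewrite -qw (valP q) in wQ.
Qed.
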